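(* Assume that each $f_i:\mathbb{R}^d\to\mathbb{R}$ ($i=1,\dots,N$) is three times continuously differentiable with bounded third derivative and is $L$-smooth, that $\sigma_*^2:=\sup_{x\in\mathbb{R}^d}\|\Sigma_{\mathrm{MB}}(x)\|_S<\infty$, and that $f$ satisfies the Polyak-Lojasiewicz inequality: there is $\mu>0$ such that $\|\nabla f(x)\|^2\ge2\mu(f(x)-f(x^\star))$ for all $x\in\mathbb{R}^d$. Let $\{x_k\}_{k\ge0}$ be the iterates of mini-batch SGD, $x_{k+1}=x_k-\eta_k\,\mathcal{G}_{\mathrm{MB}}(x_k,k)$, started at $x_0\in\mathbb{R}^d$. If $h\le1/L$, then for all $k\ge0$, $$\mathbb{E}\left[f(x_{k+1})-f(x^\star)\right]\le\left(\prod_{i=0}^k(1-\mu h\psi_i)\right)(f(x_0)-f(x^\star))+\frac{h\,d\,L\,\sigma_*^2}{2}\sum_{i=0}^k\frac{\prod_{\ell=0}^k(1-\mu h\psi_\ell)}{\prod_{j=0}^i(1-\mu h\psi_j)}\,\frac{\psi_i^2}{b_i}\,h ,$$ where the quotient of products is understood as $\prod_{\ell=i+1}^k(1-\mu h\psi_\ell)$.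
   Context: $f_1,\dots,f_N:\mathbb{R}^d\to\mathbb{R}$, $f:=\frac1N\sum_{i=1}^Nf_i$, and $x^\star\in\mathbb{R}^d$ is a global minimizer of $f$. A differentiable function $g$ is $L$-smooth if $\|\nabla g(x)-\nabla g(y)\|\le L\|x-y\|$ for all $x,y$. $\|\cdot\|$ is the Euclidean norm and $\|\cdot\|_S$ the spectral norm. The learning rates $(\eta_k)_{k\ge0}$ form a deterministic non-increasing sequence of positive numbers; $h:=\eta_0$ and $\psi_k:=\eta_k/h$. The mini-batch gradient estimator is $\mathcal{G}_{\mathrm{MB}}(x_k,k):=\frac1{b_k}\sum_{i_k\in\Omega_k}\nabla f_{i_k}(x_k)$, where the $b_k\ge1$ indices in the mini-batch $\Omega_k$ are sampled, at each iteration, independently, uniformly and with replacement from $\{1,\dots,N\}$ (independently of the past). The one-sample covariance is $$\Sigma_{\mathrm{MB}}(x):=\frac1N\sum_{i=1}^N(\nabla f(x)-\nabla f_i(x))(\nabla f(x)-\nabla f_i(x))^T .$$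
   Formalization: If f is constant, the formal statement additionally assumes μh ≤ 1; otherwise the claim fails (d=1, f₁(x)=x, f₂(x)=−x, L=h=η_k=b_k=1, μ=3, k=1 gives 0 ≤ −1/2). Nothing is added for non-constant f. *)

(* Defs.v *)
(* R^d is represented by the column vectors 'cV[R]_d, for R : realType. *)
From HB Require Import structures.
From mathcomp Require Import all_boot all_order all_algebra.
From mathcomp Require Import all_classical all_reals all_analysis.

Set Implicit Arguments.
Unset Strict Implicit.
Unset Printing Implicit Defensive.

Import Order.TTheory GRing.Theory Num.Theory.
Import numFieldNormedType.Exports.

Local Open Scope classical_set_scope.
Local Open Scope ring_scope.

(* The library norm `|v| on matrices is the sup norm, hence a separate
   Euclidean norm.  Both induce the same topology and the same derivatives. *)
Definition enorm (R : realType) (d : nat) (v : 'cV[R]_d) : R :=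
  Num.sqrt (\sum_(i < d) v i ord0 ^+ 2).

(* Operator norm induced by enorm.  The set is nonempty and bounded above, so
   this real sup is a genuine supremum. *)
Definition spectral_norm (R : realType) (d : nat) (A : 'M[R]_d) : R :=
  sup [set enorm (A *m v) | v in [set v : 'cV[R]_d | enorm v <= 1]].

Definition partial (R : realType) (d : nat) (i : 'I_d) (g : 'cV[R]_d -> R) :
    'cV[R]_d -> R :=
  fun x => 'D_(delta_mx i ord0) g x.

Definition grad (R : realType) (d : nat) (g : 'cV[R]_d -> R) (x : 'cV[R]_d) :
    'cV[R]_d :=
  \col_(i < d) partial i g x.

Fixpoint class_C (R : realType) (d n : nat) (g : 'cV[R]_d -> R) : Prop :=
  if n is m.+1
  then (forall x, differentiable g x) /\ (forall i, class_C m (partial i g))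
  else continuous g.

Definition bounded_third_derivative (R : realType) (d : nat)
    (g : 'cV[R]_d -> R) : Prop :=
  exists M : R, forall (i j l : 'I_d) (x : 'cV[R]_d),
    `|partial i (partial j (partial l g)) x| <= M.

Definition L_smooth (R : realType) (d : nat) (L : R) (g : 'cV[R]_d -> R) :
    Prop :=
  (forall x, differentiable g x) /\
  (forall x y, enorm (grad g x - grad g y) <= L * enorm (x - y)).

Definition objective (R : realType) (d N : nat) (F : 'I_N -> 'cV[R]_d -> R)
    (x : 'cV[R]_d) : R :=
  N%:R^-1 * \sum_(i < N) F i x.

Definition global_minimizer (R : realType) (d : nat) (g : 'cV[R]_d -> R)
    (xstar : 'cV[R]_d) : Prop :=
  forall x, g xstar <= g x.

(* When xstar is a global minimizer of an L-smooth g, this forces mu <= L unless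
   g is constant; a constant g satisfies it for every mu, so that mu is then not
   bounded by L. *)
Definition polyak_lojasiewicz (R : realType) (d : nat) (mu : R)
    (g : 'cV[R]_d -> R) (xstar : 'cV[R]_d) : Prop :=
  forall x, 2 * mu * (g x - g xstar) <= enorm (grad g x) ^+ 2.

Definition SigmaMB (R : realType) (d N : nat) (F : 'I_N -> 'cV[R]_d -> R)
    (x : 'cV[R]_d) : 'M[R]_d :=
  N%:R^-1 *: \sum_(i < N)
    ((grad (objective F) x - grad (F i) x) *m
     (grad (objective F) x - grad (F i) x)^T).

(* This is sigma_*^2 itself, not its square root. *)
Definition sigma_star2 (R : realType) (d N : nat)
    (F : 'I_N -> 'cV[R]_d -> R) : \bar R :=
  ereal_sup [set (spectral_norm (SigmaMB F x))%:E | x in [set: 'cV[R]_d]].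

(* Each A-valued variable X j is measurable, and the family is mutually
   independent, for the discrete sigma-algebra on the finite type A. *)
Definition independent_discrete_RVs (disp : measure_display)
    (T : measurableType disp) (R : realType) (P : probability T R)
    (J : eqType) (A : finType) (X : J -> T -> A) : Prop :=
  (forall (j : J) (B : set A), measurable (X j @^-1` B)) /\
  (forall (s : seq J) (B : J -> set A), uniq s ->
    P (\bigcap_(j in [set` s]) X j @^-1` B j) =
    (\prod_(j <- s) P (X j @^-1` B j))%E).

(* idx k j is the j-th index of the mini-batch drawn at iteration k.  As the
   starting point of the algorithm is deterministic, joint independence over
   all pairs (k, j) covers both the independence within a batch and the
   independence of each batch from the past. *)
Definition minibatch_sampling (disp : measure_display)
    (T : measurableType disp) (R : realType) (P : probability T R)
    (N : nat) (b : nat -> nat) (idx : forall k, 'I_(b k) -> T -> 'I_N) : Prop :=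
  independent_discrete_RVs P
    (fun kj : {k : nat & 'I_(b k)} => idx (tag kj) (tagged kj)) /\
  (forall k (j : 'I_(b k)) (i : 'I_N),
    P (idx k j @^-1` [set i]) = (N%:R^-1)%:E).

Definition gradMB (R : realType) (d N : nat) (F : 'I_N -> 'cV[R]_d -> R)
    (bk : nat) (Omega : 'I_bk -> 'I_N) (x : 'cV[R]_d) : 'cV[R]_d :=
  bk%:R^-1 *: \sum_(j < bk) grad (F (Omega j)) x.

Fixpoint sgd (R : realType) (d N : nat) (F : 'I_N -> 'cV[R]_d -> R)
    (T : Type) (eta : nat -> R) (b : nat -> nat)
    (idx : forall k, 'I_(b k) -> T -> 'I_N) (x0 : 'cV[R]_d) (k : nat) (w : T) :
    'cV[R]_d :=
  if k is m.+1
  then sgd F eta idx x0 m w -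
       eta m *: gradMB F (fun j => idx m j w) (sgd F eta idx x0 m w)
  else x0.

(* Main.v *)
Require Import Defs.
From HB Require Import structures.
From mathcomp Require Import all_boot all_order all_algebra.
From mathcomp Require Import all_classical all_reals all_analysis.
From mathcomp Require Import ring lra.

Set Implicit Arguments.
Unset Strict Implicit.
Unset Printing Implicit Defensive.

Import Order.TTheory GRing.Theory Num.Theory.
Import numFieldNormedType.Exports.

Local Open Scope classical_set_scope.
Local Open Scope ring_scope.

(** In expectation, one step of SGD is a gradient step on an L-smooth function
    plus a noise term.  Averaging the descent inequalities of the [F i]
    ([L_smooth_descent]) gives one for the objective ([objective_descent]):
<<
    f (x - eta G) <= f x - eta <grad f x, G> + (L eta^2 / 2) |G|^2.
>>
    Averaged over the mini-batch, the estimator G is unbiased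
    ([avg_dotv_gradMB]) and E |G|^2 = |grad f x|^2 + tr Sigma(x) / b
    ([avg_sqr_gradMB]).  As eta L <= 1, half of the decrease eta |grad f x|^2
    survives; the Polyak-Lojasiewicz inequality turns it into
    mu eta (f x - f xstar), and tr Sigma(x) <= d sigma_*^2 because every diagonal
    entry is at most the spectral norm ([trace_SigmaMB_le]).  This is the
    one-step contraction [avg_sgd_step]; it is iterated by
    [unroll_affine_recursion], which needs the factors 1 - mu eta_k to be
    nonnegative.  They are: if f is not constant then mu <= L
    ([PL_le_smoothness]), and the constant case is covered by a hypothesis of
    the theorem.

    The probability space enters only through the finite history of all indices
    drawn before iteration k: the iterate is a function of it ([sgd_hist_of]) and
    independence makes it uniformly distributed ([hist_of_uniform]).
    Expectations are therefore plain averages over the finite type [hist N b k],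
    and conditioning on the past is the splitting of an average over a product
    ([avg_pair]). *)

(** * Euclidean inner product and descent inequality *)

Definition dotv (R : realType) (d : nat) (u v : 'cV[R]_d) : R :=
  \sum_(i < d) u i ord0 * v i ord0.

Section Euclidean.
Context {R : realType} {d : nat}.
Implicit Types (u v : 'cV[R]_d) (c : R).

Lemma enorm_sqr u : enorm u ^+ 2 = dotv u u.
Proof.
rewrite /enorm sqr_sqrtr; last by apply: sumr_ge0 => i _; exact: sqr_ge0.
by apply: eq_bigr => i _; rewrite expr2.
Qed.

Lemma enorm_ge0 u : 0 <= enorm u. Proof. exact: sqrtr_ge0. Qed.

Lemma dotvv_ge0 u : 0 <= dotv u u.
Proof. by rewrite -enorm_sqr sqr_ge0. Qed.

Lemma dotvBl u v w : dotv (u - v) w = dotv u w - dotv v w.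
Proof.
rewrite /dotv -sumrB; apply: eq_bigr => i _.
by rewrite !mxE mulrBl.
Qed.

Lemma dotvZl c u v : dotv (c *: u) v = c * dotv u v.
Proof. by rewrite /dotv mulr_sumr; apply: eq_bigr => i _; rewrite mxE mulrA. Qed.

Lemma dotvC u v : dotv u v = dotv v u.
Proof. by apply: eq_bigr => i _; rewrite mulrC. Qed.

Lemma dotvZr c u v : dotv u (c *: v) = c * dotv u v.
Proof. by rewrite dotvC dotvZl dotvC. Qed.

Lemma dotv_suml (I : finType) (U : I -> 'cV[R]_d) v :
  dotv (\sum_i U i) v = \sum_i dotv (U i) v.
Proof.
rewrite /dotv exchange_big; apply: eq_bigr => i _.
by rewrite summxE mulr_suml.
Qed.

(** Expansion of the square of [u - c *: v]; with [c] a Lipschitz bound it does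
    the work of the Cauchy-Schwarz inequality in [L_smooth_descent]. *)
Lemma dotv_young c u v : 2 * c * dotv u v <= dotv u u + c ^+ 2 * dotv v v.
Proof.
have := dotvv_ge0 (u - c *: v).
rewrite dotvBl dotvZl [dotv u (_ - _)]dotvC [dotv v (_ - _)]dotvC.
rewrite !dotvBl !dotvZl [dotv v u]dotvC; lra.
Qed.

End Euclidean.

Section Gradient.
Context {R : realType} {d : nat}.
Implicit Types (g : 'cV[R]_d -> R) (u v x : 'cV[R]_d).

(** [grad] collects the derivatives along the basis vectors, so this is linearity
    of the differential. *)
Lemma derive_dotv_grad g x v :
  differentiable g x -> 'D_v g x = dotv (grad g x) v.
Proof.
move=> dg; rewrite deriveE// {1}[v]matrix_sum_delta.
rewrite linear_sum; apply: eq_bigr => i _.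
by rewrite big_ord1 linearZ/= -deriveE// mulrC mxE.
Qed.

Lemma is_derive_line g x v (t : R) :
  differentiable g (x + t *: v) ->
  is_derive t 1 (fun s : R => g (x + s *: v)) (dotv (grad g (x + t *: v)) v).
Proof.
move=> dg; rewrite -derive_dotv_grad//.
(* The two difference quotients coincide, since
   x + (h + t) v = h v + (x + t v). *)
have gE : (fun h : R => h^-1 *: (((fun s : R => g (x + s *: v)) \o shift t)
    (h *: (1 : R)) - g (x + t *: v))) =
  (fun h : R => h^-1 *: ((g \o shift (x + t *: v)) (h *: v) - g (x + t *: v))).
  apply/funext => h /=; congr (_ *: (g _ - _)).
  by rewrite scalerDl [h *: 1]mulr1 addrCA.
have D : derivable g (x + t *: v) v by exact: diff_derivable.
by split; rewrite /derivable /derive gE.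
Qed.

(** The function [phi] below is g along the segment minus the claimed upper
    bound, up to a constant.  Its derivative is at most 0 on ]0, 1[ since the
    gradient is L-Lipschitz, so the mean value theorem gives phi 1 <= phi 0. *)
Lemma L_smooth_descent (L : R) g : 0 < L -> L_smooth L g ->
  forall x v, g (x + v) <= g x + dotv (grad g x) v + L / 2 * dotv v v.
Proof.
move=> L0 [dg Lg] x v.
pose phi (t : R) := g (x + t *: v) - dotv (grad g x) v * t
                    - L / 2 * dotv v v * t ^+ 2.
pose dphi (t : R) := dotv (grad g (x + t *: v) - grad g x) v
                     - L * t * dotv v v.
have phiD (t : R) : is_derive t 1 phi (dphi t).
  have /is_derive_line H := dg (x + t *: v).
  apply: is_derive_eq.
  by rewrite /dphi dotvBl /GRing.scale /=; field.
have phi_cont : {within `[0, 1], continuous phi}.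
  apply: continuous_subspaceT => t.
  by apply/differentiable_continuous/derivable1_diffP/ex_derive.
have [t /andP[t0 t1] phi01] := MVT ltr01 (fun t _ => phiD t) phi_cont.
have dphi_le0 : dphi t <= 0.
  have := Lg (x + t *: v) x.
  rewrite addrAC subrr add0r => {}Lg.
  have {}Lg : dotv (grad g (x + t *: v) - grad g x)
                   (grad g (x + t *: v) - grad g x) <=
              (L * t) ^+ 2 * dotv v v.
    rewrite -enorm_sqr (le_trans (lerXn2r _ _ _ Lg)) ?nnegrE//.
    - exact: enorm_ge0.
    - by rewrite mulr_ge0 ?enorm_ge0// ltW.
    - by rewrite exprMn enorm_sqr dotvZl dotvZr; lra.
  (* Young's inequality with c = L t, divided by 2 L t > 0. *)
  have Lt0 : 0 < L * t by rewrite mulr_gt0.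
  have := dotv_young (L * t) (grad g (x + t *: v) - grad g x) v.
  move=> /le_trans /(_ (lerD Lg (lexx _))).
  rewrite /dphi -(pmulr_rle0 _ Lt0). lra.
move: phi01; rewrite subr0 mulr1 /phi => phi01.
move: dphi_le0; rewrite -phi01 scale0r scale1r addr0; lra.
Qed.

End Gradient.

(** * Averages over finite types *)

Definition avg (R : realType) (A : finType) (g : A -> R) : R :=
  #|A|%:R^-1 * \sum_a g a.

Section Average.
Context {R : realType}.

Section Linearity.
Context {A : finType}.
Implicit Types (g : A -> R) (c : R).

Lemma eq_avg g g' : g =1 g' -> avg g = avg g'.
Proof. by move=> gg'; rewrite /avg (eq_bigr g')// => a _; exact: gg'. Qed.

Lemma avgD g g' : avg (fun a => g a + g' a) = avg g + avg g'.
Proof. by rewrite /avg big_split mulrDr. Qed.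

Lemma avgZ c g : avg (fun a => c * g a) = c * avg g.
Proof. by rewrite /avg -mulr_sumr mulrCA. Qed.

Lemma avg_sum (I : finType) (G : I -> A -> R) :
  avg (fun a => \sum_i G i a) = \sum_i avg (G i).
Proof. by rewrite /avg exchange_big mulr_sumr. Qed.

Lemma avg_const c : (0 < #|A|)%N -> avg (fun _ : A => c) = c.
Proof.
move=> A0; rewrite /avg sumr_const -[c *+ _]mulr_natl mulKf//.
by rewrite pnatr_eq0 -lt0n.
Qed.

Lemma ler_avg g g' : (forall a, g a <= g' a) -> avg g <= avg g'.
Proof. by move=> gg'; rewrite ler_wpM2l ?invr_ge0// ler_sum. Qed.

End Linearity.

(** The law of total expectation for a uniform pair. *)
Lemma avg_pair (A B : finType) (g : A * B -> R) :
  avg g = avg (fun a => avg (fun b => g (a, b))).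
Proof.
rewrite /avg card_prod natrM invfM -mulr_sumr mulrA pair_bigA.
by congr (_ * _); apply: eq_bigr => -[].
Qed.

Section Sampling.
Context {J B : finType}.

(** A uniform function J -> B has independent coordinates: this is the expansion
    of a product of sums. *)
Lemma avg_prod_coord (G : J -> B -> R) :
  avg (fun o : {ffun J -> B} => \prod_j G j (o j)) = \prod_j avg (G j).
Proof.
rewrite /avg big_split/= bigA_distr_bigA card_ffun; congr (_ * _).
by rewrite prodr_const natrX exprVn.
Qed.

Hypothesis B0 : (0 < #|B|)%N.

Lemma avg_coord (g : B -> R) j :
  avg (fun o : {ffun J -> B} => g (o j)) = avg g.
Proof.
transitivity (\prod_l avg (fun i : B => if l == j then g i else 1)).
  rewrite -avg_prod_coord; apply: eq_avg => o.
  by rewrite (bigD1 j)//= eqxx big1 ?mulr1// => l /negPf ->.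
rewrite (bigD1 j)//= eqxx big1 ?mulr1// => l /negPf ->.
exact: avg_const.
Qed.

Lemma avg_coordM (g g' : B -> R) j l : j != l ->
  avg (fun o : {ffun J -> B} => g (o j) * g' (o l)) = avg g * avg g'.
Proof.
move=> jl; have lj : l != j by rewrite eq_sym.
transitivity (\prod_m avg (fun i : B =>
    if m == j then g i else if m == l then g' i else 1)).
  rewrite -avg_prod_coord; apply: eq_avg => o.
  rewrite (bigD1 j)//= eqxx (bigD1 l)//= (negPf lj) eqxx big1 ?mulr1//.
  by move=> m /andP[/negPf -> /negPf ->].
rewrite (bigD1 j)//= eqxx (bigD1 l)//= (negPf lj) eqxx big1 ?mulr1//.
by move=> m /andP[/negPf -> /negPf ->]; exact: avg_const.
Qed.

(** Cross terms vanish by independence, leaving #|J| equal squares. *)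
Lemma avg_sqr_sum_centered (c : B -> R) : avg c = 0 ->
  avg (fun o : {ffun J -> B} => (\sum_j c (o j)) ^+ 2) =
  #|J|%:R * avg (fun i => c i ^+ 2).
Proof.
move=> c0.
transitivity (\sum_j \sum_l avg (fun o : {ffun J -> B} => c (o j) * c (o l))).
  rewrite -[RHS](eq_bigr _ (fun j _ => avg_sum _)) -avg_sum.
  apply: eq_avg => o; rewrite expr2 mulr_suml.
  by apply: eq_bigr => j _; rewrite mulr_sumr.
transitivity (\sum_(j : J) avg (fun i => c i ^+ 2)); last first.
  by rewrite sumr_const mulr_natl.
apply: eq_bigr => j _; rewrite (bigD1 j)//= big1 ?addr0.
  by rewrite (avg_coord (fun i => c i * c i)).
by move=> l lj; rewrite avg_coordM 1?eq_sym// c0 mul0r.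
Qed.

(** Bias-variance decomposition of the mean of #|J| independent uniform samples of
    [c], whose variance is that of one sample divided by #|J|. *)
Lemma avg_sqr_batch_mean (c : B -> R) : (0 < #|J|)%N ->
  avg (fun o : {ffun J -> B} => (#|J|%:R^-1 * \sum_j c (o j)) ^+ 2) =
  avg c ^+ 2 + #|J|%:R^-1 * avg (fun i => (avg c - c i) ^+ 2).
Proof.
move=> J0; have Jn0 : #|J|%:R != 0 :> R by rewrite pnatr_eq0 -lt0n.
pose e i := avg c - c i.
have e0 : avg e = 0.
  rewrite (eq_avg (g' := fun i => avg c + -1 * c i)).
    by rewrite avgD avg_const// (avgZ (-1) c) mulN1r subrr.
  by move=> i; rewrite /e mulN1r.
transitivity (avg (fun o : {ffun J -> B} => avg c ^+ 2 +
    (- (2 * avg c * #|J|%:R^-1) * \sum_j e (o j) +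
     #|J|%:R^-1 ^+ 2 * (\sum_j e (o j)) ^+ 2))).
  apply: eq_avg => o.
  have -> : \sum_j c (o j) = #|J|%:R * avg c - \sum_j e (o j).
    rewrite sumrB sumr_const mulr_natl; lra.
  by field.
rewrite avgD avg_const; last by rewrite card_ffun expn_gt0 B0.
rewrite avgD !avgZ avg_sum big1; last by move=> j _; rewrite avg_coord.
by rewrite avg_sqr_sum_centered// /e; field.
Qed.

End Sampling.
End Average.

(** * Covariance of a single sample *)

Section Covariance.
Context {R : realType} {d : nat}.

(** A bound uniform in [v]: it makes the set defining [spectral_norm] bounded, so
    that its real supremum dominates each of its elements. *)
Lemma enorm_mulmx_le (A : 'M[R]_d) (v : 'cV[R]_d) : enorm v <= 1 ->
  enorm (A *m v) <= Num.sqrt (\sum_i (\sum_j `|A i j|) ^+ 2).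
Proof.
move=> v1; rewrite ler_sqrt; last by apply: sumr_ge0 => i _; exact: sqr_ge0.
have vj j : `|v j ord0| <= 1.
  rewrite -(@ler_pXn2r _ 2)// ?nnegrE// expr1n real_normK ?num_real//.
  rewrite (le_trans _ (_ : enorm v ^+ 2 <= 1)) ?exprn_ile1 ?enorm_ge0//.
  rewrite enorm_sqr /dotv (bigD1 j)//= -expr2 lerDl sumr_ge0// => i _.
  by rewrite -expr2 sqr_ge0.
apply: ler_sum => i _; rewrite mxE.
rewrite -real_normK ?num_real// lerXn2r ?nnegrE ?sumr_ge0//.
rewrite (le_trans (ler_norm_sum _ _ _))// ler_sum// => j _.
by rewrite normrM ler_piMr.
Qed.

(** The entry is a coordinate of [A *m e_i], where the basis vector e_i has norm 1. *)
Lemma diag_le_spectral_norm (A : 'M[R]_d) i : A i i <= spectral_norm A.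
Proof.
have e1 : enorm (delta_mx i ord0 : 'cV[R]_d) <= 1.
  rewrite /enorm (bigD1 i)//= mxE !eqxx expr1n big1 ?addr0 ?sqrtr1//.
  by move=> j /negPf ji; rewrite mxE ji/= expr0n.
apply: (@le_trans _ _ (enorm (A *m delta_mx i ord0))); last first.
  apply: ub_le_sup; last by exists (delta_mx i ord0).
  by eexists => _ [v v1 <-]; exact: enorm_mulmx_le.
rewrite -colE (le_trans (ler_norm _))// /enorm -sqrtr_sqr ler_sqrt; last first.
  by apply: sumr_ge0 => j _; exact: sqr_ge0.
by rewrite (bigD1 i)//= mxE lerDl sumr_ge0// => j _; exact: sqr_ge0.
Qed.

Context {N : nat}.
Variable F : 'I_N -> 'cV[R]_d -> R.

Lemma trace_SigmaMB_le x : (sigma_star2 F < +oo)%E ->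
  \tr (SigmaMB F x) <= d%:R * fine (sigma_star2 F).
Proof.
move=> sfin.
have sub y : ((spectral_norm (SigmaMB F y))%:E <= sigma_star2 F)%E.
  by apply: ereal_sup_ubound; exists y.
have s_fin : sigma_star2 F \is a fin_num.
  by rewrite fin_numElt sfin (lt_le_trans (ltNyr _) (sub x)).
rewrite -[d in d%:R]card_ord -sum1_card natr_sum mulr_suml ler_sum// => i _.
rewrite mul1r (le_trans (diag_le_spectral_norm _ i))//.
by rewrite -lee_fin fineK.
Qed.

Lemma objective_avg x : objective F x = avg (fun i => F i x).
Proof. by rewrite /avg card_ord. Qed.

(** The trace is the variance of a single sample, summed over coordinates; this
    is the form in which it comes out of [avg_sqr_batch_mean]. *)
Lemma trace_SigmaMB x : \tr (SigmaMB F x) =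
  \sum_j avg (fun i => (grad (objective F) x j ord0 - grad (F i) x j ord0) ^+ 2).
Proof.
apply: eq_bigr => j _; rewrite /SigmaMB mxE summxE /avg card_ord.
congr (_ * _); apply: eq_bigr => i _.
by rewrite mxE big_ord1 !mxE expr2.
Qed.

Hypothesis dF : forall i x, differentiable (F i) x.

Lemma grad_objective x : grad (objective F) x = N%:R^-1 *: \sum_i grad (F i) x.
Proof.
apply/colP => j; rewrite !mxE summxE /partial.
have -> : objective F = N%:R^-1 \*: (\sum_i F i).
  by apply/funext => y; rewrite /objective /= fct_sumE.
have D i : derivable (F i) x (delta_mx j ord0) by exact: diff_derivable.
rewrite deriveZ; last exact: derivable_sum.
by rewrite derive_sum//; congr (_ * _); apply: eq_bigr => i _; rewrite mxE.
Qed.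

Lemma grad_objectiveE x j :
  grad (objective F) x j ord0 = avg (fun i => grad (F i) x j ord0).
Proof. by rewrite grad_objective mxE summxE /avg card_ord. Qed.

End Covariance.

(** * One step of mini-batch SGD *)

Section Step.
Context {R : realType} {d N : nat}.
Variables (F : 'I_N -> 'cV[R]_d -> R) (L : R).
Hypotheses (N0 : (0 < N)%N) (L0 : 0 < L) (smoothF : forall i, L_smooth L (F i)).

Let f := objective F.

Lemma objective_descent x v :
  f (x + v) <= f x + dotv (grad f x) v + L / 2 * dotv v v.
Proof.
have cN : (0 < #|'I_N|)%N by rewrite card_ord.
have -> : dotv (grad f x) v = avg (fun i => dotv (grad (F i) x) v).
  rewrite grad_objective; last by move=> i; case: (smoothF i).
  by rewrite dotvZl dotv_suml /avg card_ord.
rewrite /f !objective_avg -[L / 2 * _](avg_const _ cN) -!avgD.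
by apply: ler_avg => i; exact: L_smooth_descent.
Qed.

(** The gradient step of length 1/L from [y] gives
    |grad f y|^2 <= 2 L (f y - f xstar), as its endpoint is not below the minimum;
    compare with the Polyak-Lojasiewicz bound at a [y] with a positive gap. *)
Lemma PL_le_smoothness mu xstar : global_minimizer f xstar ->
  polyak_lojasiewicz mu f xstar -> (exists y, f y <> f xstar) -> mu <= L.
Proof.
move=> fmin pl [y /eqP fy].
have gap : 0 < f y - f xstar by rewrite subr_gt0 lt_neqAle eq_sym fy fmin.
have := objective_descent y (- L^-1 *: grad f y).
rewrite !dotvZl !dotvZr.
set q := dotv (grad f y) (grad f y) => step.
have {}step : q <= 2 * L * (f y - f xstar).
  have := le_trans (fmin _) step.
  have -> : f y + - L^-1 * q + L / 2 * (- L^-1 * (- L^-1 * q)) =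
    f y - q / (2 * L) by field; rewrite gt_eqF.
  move=> gap_q; rewrite mulrC -ler_pdivrMr ?mulr_gt0//; lra.
have := pl y; rewrite enorm_sqr -/q => /le_trans /(_ step).
by rewrite ler_pM2r// ler_pM2l.
Qed.

Section Batch.
Variable b : nat.
Hypothesis b0 : (0 < b)%N.

Lemma avg_dotv_gradMB u x :
  avg (fun o : {ffun 'I_b -> 'I_N} => dotv (gradMB F o x) u) =
  dotv (grad f x) u.
Proof.
have dF i y : differentiable (F i) y by case: (smoothF i).
have bn0 : b%:R != 0 :> R by rewrite pnatr_eq0 -lt0n.
rewrite avg_sum; apply: eq_bigr => j _.
transitivity (avg (fun o : {ffun 'I_b -> 'I_N} =>
    u j ord0 / b%:R * \sum_l grad (F (o l)) x j ord0)).
  by apply: eq_avg => o; rewrite !mxE summxE; field.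
rewrite avgZ avg_sum (eq_bigr (fun=> grad f x j ord0)); last first.
  move=> l _; rewrite (avg_coord _ (fun i => grad (F i) x j ord0)) ?card_ord//.
  by rewrite grad_objectiveE.
by rewrite sumr_const card_ord -[_ *+ b]mulr_natl; field.
Qed.

(** [avg_sqr_batch_mean] in each coordinate. *)
Lemma avg_sqr_gradMB x :
  avg (fun o : {ffun 'I_b -> 'I_N} => dotv (gradMB F o x) (gradMB F o x)) =
  dotv (grad f x) (grad f x) + \tr (SigmaMB F x) / b%:R.
Proof.
have dF i y : differentiable (F i) y by case: (smoothF i).
rewrite avg_sum trace_SigmaMB mulr_suml -big_split.
apply: eq_bigr => j _ /=.
rewrite grad_objectiveE// -expr2 [in RHS]mulrC -[in b%:R](card_ord b).
rewrite -avg_sqr_batch_mean ?card_ord//.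
by apply: eq_avg => o; rewrite -expr2 !mxE summxE.
Qed.

(** The curvature term (L eta^2 / 2) |grad f x|^2 uses up at most half of the
    decrease eta |grad f x|^2, since eta L <= 1; the other half is bounded below
    by the Polyak-Lojasiewicz inequality. *)
Lemma avg_sgd_step mu xstar eta s x :
  polyak_lojasiewicz mu f xstar -> 0 < eta -> eta * L <= 1 ->
  \tr (SigmaMB F x) <= s ->
  avg (fun o : {ffun 'I_b -> 'I_N} => f (x - eta *: gradMB F o x) - f xstar) <=
  (1 - mu * eta) * (f x - f xstar) + eta ^+ 2 * L * s / (2 * b%:R).
Proof.
move=> pl eta0 etaL trs.
have bn0 : b%:R != 0 :> R by rewrite pnatr_eq0 -lt0n.
have c0 : (0 < #|{ffun 'I_b -> 'I_N}|)%N by rewrite card_ffun expn_gt0 card_ord N0.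
pose q := dotv (grad f x) (grad f x).
have mean_step : avg (fun o : {ffun 'I_b -> 'I_N} =>
      f (x - eta *: gradMB F o x) - f xstar) <=
    (f x - f xstar) - eta * q + eta ^+ 2 * L / 2 * (q + \tr (SigmaMB F x) / b%:R).
  rewrite -avg_sqr_gradMB /q -[- (eta * _)]mulNr -avg_dotv_gradMB -!avgZ.
  rewrite -[f x - f xstar](avg_const _ c0) -!avgD.
  apply: ler_avg => o; rewrite -scaleNr.
  have := objective_descent x (- eta *: gradMB F o x).
  rewrite !(dotvZl, dotvZr) [dotv (grad f x) _]dotvC; lra.
apply: (le_trans mean_step).
have q_le : eta / 2 * (2 * mu * (f x - f xstar)) <= eta / 2 * q.
  by rewrite ler_pM2l ?divr_gt0// /q -enorm_sqr.
have curv : eta ^+ 2 * L / 2 * q <= eta / 2 * q.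
  have -> : eta ^+ 2 * L / 2 * q = (eta * L) * (eta / 2 * q) by ring.
  by rewrite ler_piMl// mulr_ge0 ?dotvv_ge0// divr_ge0 // ltW.
have noise : eta ^+ 2 * L / 2 * (\tr (SigmaMB F x) / b%:R) <=
    eta ^+ 2 * L * s / (2 * b%:R).
  have -> : eta ^+ 2 * L * s / (2 * b%:R) = eta ^+ 2 * L / 2 * (s / b%:R).
    by field.
  rewrite ler_pM2l; last by rewrite divr_gt0// mulr_gt0// exprn_gt0.
  by rewrite ler_pM2r// invr_gt0 ltr0n.
lra.
Qed.

End Batch.
End Step.

(** * Finite histories *)

Fixpoint hist (N : nat) (b : nat -> nat) (k : nat) : finType :=
  if k is m.+1 then (hist N b m * {ffun 'I_(b m) -> 'I_N})%type else unit.

Fixpoint hist_sgd (R : realType) (d N : nat) (F : 'I_N -> 'cV[R]_d -> R)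
    (eta : nat -> R) (b : nat -> nat) (x0 : 'cV[R]_d) (k : nat) :
    hist N b k -> 'cV[R]_d :=
  if k is m.+1 then
    fun a => hist_sgd F eta x0 a.1 -
             eta m *: gradMB F a.2 (hist_sgd F eta x0 a.1)
  else fun=> x0.

Fixpoint hist_of (T : Type) (N : nat) (b : nat -> nat)
    (idx : forall k, 'I_(b k) -> T -> 'I_N) (k : nat) (w : T) : hist N b k :=
  if k is m.+1 then (hist_of idx m w, [ffun j => idx m j w]) else tt.

(** The positions (iteration, place in the batch) of the entries of a history. *)
Fixpoint draws (b : nat -> nat) (k : nat) : seq {k : nat & 'I_(b k)} :=
  if k is m.+1 then
    draws b m ++ [seq Tagged (fun k => 'I_(b k)) j | j <- enum 'I_(b m)]
  else [::].

Section History.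
Context {N : nat} {b : nat -> nat}.

Lemma sgd_hist_of (R : realType) (d : nat) (F : 'I_N -> 'cV[R]_d -> R)
    (T : Type) (eta : nat -> R) (idx : forall k, 'I_(b k) -> T -> 'I_N)
    (x0 : 'cV[R]_d) k w :
  sgd F eta idx x0 k w = hist_sgd F eta x0 (hist_of idx k w).
Proof.
elim: k => [|k IH]; first by [].
rewrite [LHS]/= [RHS]/= IH /gradMB; congr (_ - _ *: (_ *: _)).
by apply: eq_bigr => j _; rewrite ffunE.
Qed.

Lemma card_hist k : #|hist N b k| = (N ^ size (draws b k))%N.
Proof.
elim: k => [|k IH] /=; first by rewrite card_unit.
by rewrite card_prod IH card_ffun !card_ord size_cat size_map size_enum_ord expnD.
Qed.

Lemma draws_tag_lt k u : u \in draws b k -> (tag u < k)%N.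
Proof.
elim: k => //= k IH; rewrite mem_cat => /orP[/IH/ltnW//|/mapP[j _ ->]] /=.
exact: ltnSn.
Qed.

Lemma draws_uniq k : uniq (draws b k).
Proof.
elim: k => //= k IH; rewrite cat_uniq IH map_inj_uniq ?enum_uniq ?andbT/=.
  by apply/hasPn => _ /mapP[j _ ->]; apply/negP => /draws_tag_lt; rewrite ltnn.
by move=> i j /eqP; rewrite eq_Tagged => /eqP.
Qed.

(** An event fixing the whole history is an intersection of single-index events
    over distinct positions, which is the form of event that the independence
    hypothesis is about.  The constraints are a function of the position alone,
    with a junk value outside [draws b k]. *)
Lemma hist_of_cylinder (T : Type) (idx : forall k, 'I_(b k) -> T -> 'I_N)
    k (a : hist N b k) :
  exists c : {k : nat & 'I_(b k)} -> 'I_N -> Prop,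
    (forall u, u \in draws b k -> exists i, c u = [set i]) /\
    hist_of idx k @^-1` [set a] =
    \bigcap_(u in [set` draws b k]) idx (tag u) (tagged u) @^-1` c u.
Proof.
elim: k a => [[]|k IH [a o]].
  exists (fun=> setT); split=> //.
  by rewrite set_nil bigcap_set0; apply/seteqP; split => // w _ /=; case: hist_of.
have [c [c1 cE]] := IH a.
(* [untag] overrides the constraints at the positions of iteration k, without
   an explicit transport along tag u = k. *)
pose c' u := untag (c u) (fun j : 'I_(b k) => [set o j]) u.
have c'_old u : u \in draws b k -> c' u = c u.
  by move=> /draws_tag_lt uk; rewrite /c' untag_dflt// ltn_eqF.
have c'_new j : c' (Tagged (fun k => 'I_(b k)) j) = [set o j].
  exact: (untagE (c _) _ (erefl : tag (Tagged (fun k => 'I_(b k)) j) = k)).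
exists c'; split=> [u|] /=.
  rewrite mem_cat => /orP[uk|/mapP[j _ ->]]; last by exists (o j).
  by rewrite c'_old//; exact: c1.
apply/seteqP; split=> w /=.
  move=> [ha ho] u /=; rewrite mem_cat => /orP[uk|/mapP[j _ ->]].
    have : (hist_of idx k @^-1` [set a]) w by [].
    by rewrite c'_old// cE; exact.
  by rewrite c'_new /= -ho ffunE.
move=> cw; congr (_, _).
  change ((hist_of idx k @^-1` [set a]) w); rewrite cE => u /= uk.
  by rewrite -c'_old//; apply: cw => /=; rewrite mem_cat uk.
apply/ffunP => j; rewrite ffunE.
have := cw (Tagged (fun k => 'I_(b k)) j); rewrite c'_new; apply => /=.
by rewrite mem_cat map_f ?orbT// mem_enum.
Qed.

End History.

Section UniformHistory.
Context {disp : measure_display} {T : measurableType disp} {R : realType}.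
Variable P : probability T R.

Lemma expectation_uniform (A : finType) (H : T -> A) (g : A -> R) :
  (forall a, measurable (H @^-1` [set a])) ->
  (forall a, P (H @^-1` [set a]) = (#|A|%:R^-1)%:E) ->
  ('E_P[fun w => g (H w)] = (avg g)%:E)%E.
Proof.
move=> mH PH; rewrite unlock.
(* Decompose g o H as a combination of indicators of the fibres of H. *)
have gE w : ((g (H w))%:E =
    \sum_a (g a)%:E * (\1_(H @^-1` [set a]) w)%:E)%E.
  rewrite (bigD1 (H w))//= indicE mem_set// mule1 big1 ?adde0// => a aH.
  rewrite indicE memNset ?mule0// => /= Ha.
  by rewrite Ha eqxx in aH.
under eq_integral do rewrite gE.
have int1 a : P.-integrable setT (fun w => (\1_(H @^-1` [set a]) w)%:E).
  exact: integrable_indic.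
rewrite integral_sum//=; last by move=> a; exact: integrableZl.
rewrite /avg mulr_sumr -sumEFin; apply: eq_bigr => a _.
by rewrite integralZl// integral_indic// setIT [X in (_ * X)%E]PH -EFinM mulrC.
Qed.

Context {N : nat} {b : nat -> nat}.
Variable idx : forall k, 'I_(b k) -> T -> 'I_N.
Hypothesis sampling : minibatch_sampling P idx.

Lemma hist_of_uniform k (a : hist N b k) :
  measurable (hist_of idx k @^-1` [set a]) /\
  P (hist_of idx k @^-1` [set a]) = (#|hist N b k|%:R^-1)%:E.
Proof.
have [[midx indep] unif] := sampling.
have [c [c1 ->]] := hist_of_cylinder idx a; split.
  apply: fin_bigcap_measurable => [|u _]; first exact: finite_seq.
  exact: midx.
rewrite (indep _ _ (draws_uniq k)).
rewrite (eq_big_seq (fun=> (N%:R^-1)%:E)); last first.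
  by move=> u /c1[i ->]; exact: unif.
rewrite card_hist natrX -exprVn; elim: (draws b k) => [|u s IH].
  by rewrite big_nil.
by rewrite big_cons IH -EFinM -exprS.
Qed.

Lemma expectation_hist k (g : hist N b k -> R) :
  ('E_P[fun w => g (hist_of idx k w)] = (avg g)%:E)%E.
Proof.
by apply: expectation_uniform => a; have [] := hist_of_uniform a.
Qed.

End UniformHistory.

(** * Iteration of the one-step bound *)

Lemma unroll_affine_recursion (R : realType) (rho c a : nat -> R) :
  (forall i, 0 <= rho i) ->
  (forall i, a i.+1 <= rho i * a i + c i) ->
  forall k, a k <= (\prod_(0 <= i < k) rho i) * a 0%N +
    \sum_(0 <= i < k) (\prod_(i.+1 <= l < k) rho l) * c i.
Proof.
move=> rho0 step; elim=> [|k IH]; first by rewrite !big_geq// mul1r addr0.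
rewrite (le_trans (step k))// big_nat_recr//= [\sum_(0 <= i < k.+1) _]big_nat_recr//=.
rewrite [X in X * c k]big_geq// mul1r addrA lerD2r.
rewrite [\sum_(0 <= i < k) _](eq_big_nat _ _ (F2 := fun i =>
  rho k * ((\prod_(i.+1 <= l < k) rho l) * c i))); last first.
  by move=> i /andP[_ ik]; rewrite big_nat_recr//= mulrAC mulrC.
rewrite -mulr_sumr [_ * rho k]mulrC -mulrA -mulrDr.
exact: ler_wpM2l.
Qed.

Theorem theoremE3 (R : realType) (d N : nat) (F : 'I_N -> 'cV[R]_d -> R)
    (L mu : R) (xstar x0 : 'cV[R]_d) (eta : nat -> R) (b : nat -> nat)
    (disp : measure_display) (T : measurableType disp) (P : probability T R)
    (idx : forall k, 'I_(b k) -> T -> 'I_N) :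
  let f := objective F in
  let h := eta 0%N in
  let psi := fun k : nat => eta k / h in
  let x := sgd F eta idx x0 in
  (0 < N)%N ->
  (forall i, class_C 3 (F i)) ->
  (forall i, bounded_third_derivative (F i)) ->
  0 < L ->
  (forall i, L_smooth L (F i)) ->
  (sigma_star2 F < +oo)%E ->
  global_minimizer f xstar ->
  0 < mu ->
  polyak_lojasiewicz mu f xstar ->
  ((forall y, f y = f xstar) -> mu * h <= 1) ->
  (forall k, 0 < eta k) ->
  nonincreasing_seq eta ->
  (forall k, (1 <= b k)%N) ->
  minibatch_sampling P idx ->
  h <= 1 / L ->
  forall k : nat,
    ('E_P[fun w => (f (x k.+1 w) - f xstar)%R] <=
     ((\prod_(0 <= i < k.+1) (1 - mu * h * psi i)) * (f x0 - f xstar) +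
      h * d%:R * L * fine (sigma_star2 F) / 2 *
      \sum_(0 <= i < k.+1)
        ((\prod_(i.+1 <= l < k.+1) (1 - mu * h * psi l)) *
         (psi i ^+ 2 / (b i)%:R) * h))%R%:E)%E.
Proof.
move=> f h psi x N0 CF _ L0 smoothF sfin fmin mu0 pl const_mu eta0 eta_mono.
move=> b0 sampling hL k.
have h0 : 0 < h by exact: eta0.
have eta_h i : eta i <= h by exact: eta_mono.
have hpsi i : mu * h * psi i = mu * eta i.
  by rewrite /psi -mulrA; congr (_ * _); field; rewrite gt_eqF.
have hL1 : h * L <= 1 by rewrite -ler_pdivlMr.
have muh : mu * h <= 1.
  have [cst|/existsNP ncst] := pselect (forall y, f y = f xstar).
    exact: const_mu.
  apply: le_trans hL1; rewrite mulrC ler_pM2l//.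
  exact: (PL_le_smoothness N0 L0 smoothF fmin pl).
pose s := d%:R * fine (sigma_star2 F).
(* The expected gap at iteration i, computed on histories. *)
pose a i := avg (fun t : hist N b i => f (hist_sgd F eta x0 t) - f xstar).
have step i : a i.+1 <= (1 - mu * h * psi i) * a i +
    eta i ^+ 2 * L * s / (2 * (b i)%:R).
  have c0 : (0 < #|hist N b i|)%N by rewrite card_hist expn_gt0 N0.
  rewrite /a avg_pair -avgZ -[X in _ + X](avg_const _ c0) -avgD.
  apply: ler_avg => t; rewrite hpsi; apply: avg_sgd_step => //.
    by rewrite (le_trans _ hL1)// ler_pM2r.
  exact: trace_SigmaMB_le.
have rho0 i : 0 <= 1 - mu * h * psi i.
  by rewrite hpsi subr_ge0 (le_trans _ muh)// ler_pM2l.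
have -> : (fun w => f (x k.+1 w) - f xstar) =
    (fun w => f (hist_sgd F eta x0 (hist_of idx k.+1 w)) - f xstar).
  by apply/funext => w; rewrite /x sgd_hist_of.
rewrite (expectation_hist sampling
  (fun t : hist N b k.+1 => f (hist_sgd F eta x0 t) - f xstar)).
rewrite lee_fin (le_trans (unroll_affine_recursion rho0 step k.+1))//.
have -> : a 0%N = f x0 - f xstar.
  have c0 : (0 < #|hist N b 0|)%N by rewrite card_unit.
  exact: (avg_const (f x0 - f xstar) c0).
rewrite lerD2l mulr_sumr ler_sum// => i _.
have hn0 : h != 0 by rewrite gt_eqF.
have bn0 : (b i)%:R != 0 :> R by rewrite pnatr_eq0 -lt0n; exact: b0.
rewrite le_eqVlt; apply/orP; left; apply/eqP.
by rewrite /s /psi; field; rewrite hn0 bn0.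
Qed.
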